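(* Let $m\ge 2$ and let $A_1,\ldots,A_m\in\mathbb{M}_d$ be Hermitian. Define $C_1=A_1$ and, for $2\le j\le m$, $$C_j=C_{j-1}\vee A_j,\qquad D_j=C_{j-1}\wedge A_j .$$ Then $$C_m\oplus D_2\oplus\cdots\oplus D_m\simeq A_1\oplus\cdots\oplus A_m .$$ Moreover, for every complex-valued function $f$ on $\bigcup_{j=1}^m\sigma(A_j)$, $$\operatorname{Tr}f(C_m)+\sum_{j=2}^m\operatorname{Tr}f(D_j)=\sum_{j=1}^m\operatorname{Tr}f(A_j).$$
   Context: $\mathbb{M}_d$ is the algebra of complex $d\times d$ matrices, $\operatorname{Tr}$ is the unnormalized trace, and $\sigma(X)$ is the spectrum of $X$. For a Hermitian $X\in\mathbb{M}_d$ and $t\in\mathbb{R}$, $E_X(t)=\mathbf{1}_{(t,\infty)}(X)$ is the orthogonal projection onto the span of the eigenvectors of $X$ with eigenvalue $>t$. The spectral order on Hermitian matrices is: $A\preceq B$ iff $E_A(t)\le E_B(t)$ for all $t\in\mathbb{R}$. With this order the Hermitian matrices in $\mathbb{M}_d$ form a lattice (Olson); $A\vee B$ and $A\wedge B$ denote the supremum (join) and infimum (meet). They are characterized by $E_{A\vee B}(t)=E_A(t)\vee E_B(t)$ and $E_{A\wedge B}(t)=E_A(t)\wedge E_B(t)$ for all $t\in\mathbb{R}$, where for orthogonal projections $P,Q$ the projections $P\vee Q$ and $P\wedge Q$ are the orthogonal projections onto $\operatorname{Ran}P+\operatorname{Ran}Q$ and $\operatorname{Ran}P\cap\operatorname{Ran}Q$,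 respectively. $\oplus$ denotes the block-diagonal direct sum of matrices, and $X\simeq Y$ means $X=UYU^*$ for some unitary matrix $U$. For Hermitian $X$, $f(X)$ is defined by the functional calculus; the spectra of $C_m$ and of the $D_j$ are contained in $\bigcup_{j=1}^m\sigma(A_j)$, so that $f(C_m)$ and $f(D_j)$ make sense. *)

(* Defs.v *)
From HB Require Import structures.
From mathcomp Require Import all_boot all_order all_algebra.
From mathcomp Require Import boolp classical_sets reals.
From mathcomp Require Import complex.

Set Implicit Arguments.
Unset Strict Implicit.
Unset Printing Implicit Defensive.

Import Order.TTheory GRing.Theory Num.Theory.
Local Open Scope ring_scope.
Local Open Scope complex_scope.
Local Open Scope sesquilinear_scope.
Local Open Scope classical_set_scope.

(* [X \is hermsymmx] is the library's "X equals its conjugate transpose". *)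

(* The library's decomposition of a normal X reads X = V^* diag(s) V with
   V = spectralmx X unitary and s = spectral_diag X, so that
   f(X) = V^* diag(f o s) V. Only the values of f on the spectrum of X
   matter. For a non-normal X the result is meaningless. *)
Definition funcalc (R : realType) (d : nat) (f : R[i] -> R[i])
    (X : 'M[R[i]]_d) : 'M[R[i]]_d :=
  (spectralmx X)^t* *m diag_mx (map_mx f (spectral_diag X)) *m spectralmx X.

(* E_X(t) = 1_{(t, oo)}(X). On R[i], [t%:C < z] means that z is real and
   greater than t. *)
Definition specproj (R : realType) (d : nat) (X : 'M[R[i]]_d) (t : R) :
    'M[R[i]]_d :=
  funcalc (fun z => ((t%:C < z)%R : bool)%:R) X.

(* [0 <= z] on R[i] includes that z is real. *)
Definition loewner_le (R : realType) (d : nat) (P Q : 'M[R[i]]_d) : Prop :=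
  forall v : 'cV[R[i]]_d, 0 <= (v^t* *m (Q - P) *m v) 0 0.

Definition spectral_le (R : realType) (d : nat) (A B : 'M[R[i]]_d) : Prop :=
  forall t : R, loewner_le (specproj A t) (specproj B t).

Definition is_spectral_sup (R : realType) (d : nat) (A B C : 'M[R[i]]_d) :
    Prop :=
  [/\ C \is hermsymmx, spectral_le A C, spectral_le B C
    & forall X : 'M[R[i]]_d, X \is hermsymmx ->
        spectral_le A X -> spectral_le B X -> spectral_le C X].

Definition is_spectral_inf (R : realType) (d : nat) (A B C : 'M[R[i]]_d) :
    Prop :=
  [/\ C \is hermsymmx, spectral_le C A, spectral_le C B
    & forall X : 'M[R[i]]_d, X \is hermsymmx ->
        spectral_le X A -> spectral_le X B -> spectral_le X C].

(* [xget] picks the supremum (infimum), which exists and is unique for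
   Hermitian A and B by Olson's theorem; its default value 0 is then unused. *)
Definition spectral_join (R : realType) (d : nat) (A B : 'M[R[i]]_d) :
    'M[R[i]]_d :=
  xget 0 [set C | is_spectral_sup A B C].

Definition spectral_meet (R : realType) (d : nat) (A B : 'M[R[i]]_d) :
    'M[R[i]]_d :=
  xget 0 [set C | is_spectral_inf A B C].

Definition unitarily_equiv (R : realType) (n : nat) (X Y : 'M[R[i]]_n) : Prop :=
  exists2 U : 'M[R[i]]_n, U \is unitarymx & X = U *m Y *m U^t*.

(* Main.v *)
Require Import Defs.
From mathcomp Require Import all_boot all_order all_algebra.
From mathcomp Require Import perm classical_sets reals complex.
Import Order.TTheory GRing.Theory Num.Theory.
Local Open Scope ring_scope.
Local Open Scope complex_scope.

(** Everything reduces to the case of two Hermitian matrices A, B. The map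
    t |-> Ran E_A(t) + Ran E_B(t) is a decreasing step function from the reals
    to subspaces, and such a function is always the family of spectral
    subspaces of some Hermitian matrix ([exists_spectral_family]). As the
    Loewner order on projections is inclusion of ranges
    ([loewner_orthoproj]), that matrix is the join of A and B
    ([spectral_joinP]); intersections give the meet in the same way
    ([spectral_meetP]).

    The rank of E_X(t) is the number of eigenvalues of X above t
    ([rank_specproj]), so the dimension formula for a sum and an intersection
    of subspaces says that, above every t, the join and the meet together have
    as many eigenvalues as A and B together. Two finite lists of reals with the
    same counts above every t agree up to order ([perm_eq_count_gt]). Hence
    Tr f(A \/ B) + Tr f(A /\ B) = Tr f(A) + Tr f(B) for every f
    ([tr_funcalc_join_meet]), and the trace formula for m matrices is a
    telescoping sum of these identities.

    The trace formula implies the unitary equivalence. The functional calculus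
    acts blockwise on block-diagonal matrices ([funcalc_mxdiag]), so the two
    direct sums have the same Tr f for all f; with f the indicator of a point
    this says that they have the same eigenvalues with multiplicities, and
    Hermitian matrices with the same eigenvalues are unitarily equivalent
    ([unitarily_equiv_of_trace]). *)

Set Implicit Arguments.
Unset Strict Implicit.
Unset Printing Implicit Defensive.
Local Open Scope sesquilinear_scope.

(** * Adjoints and Hermitian matrices *)

Lemma adjmxM (C : numClosedFieldType) (m n p : nat)
    (A : 'M[C]_(m, n)) (B : 'M[C]_(n, p)) :
  (A *m B)^t* = B^t* *m A^t*.
Proof. by rewrite trmx_mul map_mxM. Qed.

Lemma adjmxB (C : numClosedFieldType) (m n : nat) (A B : 'M[C]_(m, n)) :
  (A - B)^t* = A^t* - B^t*.
Proof. by apply/matrixP => i j; rewrite !mxE rmorphB. Qed.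

Lemma adjmxZ (C : numClosedFieldType) (m n : nat) (a : C) (A : 'M[C]_(m, n)) :
  (a *: A)^t* = a^*%R *: A^t*.
Proof. by apply/matrixP => i j; rewrite !mxE rmorphM. Qed.

Lemma adjmx_sum (C : numClosedFieldType) (m n k : nat) (A : 'I_k -> 'M[C]_(m, n)) :
  (\sum_i A i)^t* = \sum_i (A i)^t*.
Proof.
apply/matrixP => p q; rewrite 2!mxE !summxE rmorph_sum.
by apply: eq_bigr => i _; rewrite !mxE.
Qed.

Lemma hermsymmxP (C : numClosedFieldType) (n : nat) (X : 'M[C]_n) :
  reflect (X^t* = X) (X \is hermsymmx).
Proof.
apply: (iffP idP) => [/is_hermitianmxP|XE].
  by rewrite expr0 scale1r => <-.
by apply/is_hermitianmxP; rewrite expr0 scale1r XE.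
Qed.

Lemma spectralE (R : realType) (d : nat) (X : 'M[R[i]]_d) :
  X \is hermsymmx ->
  X = (spectralmx X)^t* *m diag_mx (spectral_diag X) *m spectralmx X.
Proof.
move=> /hermitian_normalmx/orthomx_spectralP {1}->.
by rewrite invmx_unitary // spectral_unitarymx.
Qed.

Lemma mul_spectralmx_adj (R : realType) (d : nat) (X : 'M[R[i]]_d) :
  X \is hermsymmx ->
  X *m (spectralmx X)^t* = (spectralmx X)^t* *m diag_mx (spectral_diag X).
Proof.
move=> /spectralE; have /unitarymxP := spectral_unitarymx X.
move: (spectralmx X) (diag_mx _) => V S VV XE.
by rewrite XE -[LHS]mulmxA VV mulmx1.
Qed.

(** * Functional calculus *)

(** The eigenvector matrix [spectralmx X] is not unique; intertwining is what
    makes [funcalc] independent of it. Entry (i, j) of the hypothesis, written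
    in the eigenbasis V of X, says [r_i z_ij = z_ij s_j] with [z = V Y]: either
    [z_ij = 0] or [r_i = s_j], and both survive the application of [f]. *)
Lemma funcalc_intertwine (R : realType) (d n : nat) (f : R[i] -> R[i])
    (X : 'M[R[i]]_d) (Y : 'M[R[i]]_(d, n)) (s : 'rV[R[i]]_n) :
  X \is hermsymmx -> X *m Y = Y *m diag_mx s ->
  funcalc f X *m Y = Y *m diag_mx (map_mx f s).
Proof.
move=> /spectralE XE XY; rewrite /funcalc.
set V := spectralmx X in XE *; set r := spectral_diag X in XE *.
have VV : V *m V^t* = 1%:M by apply/unitarymxP/spectral_unitarymx.
have VV' : V^t* *m V = 1%:M by apply: mulmx1C.
have ZE : diag_mx r *m (V *m Y) = V *m Y *m diag_mx s.
  by rewrite -[RHS]mulmxA -XY XE !mulmxA VV mul1mx.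
have fE : diag_mx (map_mx f r) *m (V *m Y) = V *m Y *m diag_mx (map_mx f s).
  move: (V *m Y) ZE => Z /matrixP ZE; apply/matrixP => i j; move: (ZE i j).
  rewrite !mul_diag_mx !mul_mx_diag !mxE.
  have [->|nz] := eqVneq (Z i j) 0; first by rewrite !mulr0 !mul0r.
  by rewrite mulrC => /(mulfI nz) ->; rewrite mulrC.
by rewrite -!mulmxA fE !mulmxA VV' mul1mx.
Qed.

Lemma funcalc_eigen (R : realType) (d n : nat) (f : R[i] -> R[i])
    (X : 'M[R[i]]_d) (Y : 'M[R[i]]_(d, n)) (a : R[i]) :
  X \is hermsymmx -> X *m Y = a *: Y -> funcalc f X *m Y = f a *: Y.
Proof.
move=> hX XY; rewrite (@funcalc_intertwine _ _ _ _ _ _ (const_mx a)) //.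
  by rewrite map_const_mx diag_const_mx mul_mx_scalar.
by rewrite XY diag_const_mx mul_mx_scalar.
Qed.

Lemma eq_funcalc (R : realType) (d : nat) (f g : R[i] -> R[i]) (X : 'M[R[i]]_d) :
  (forall j, f (spectral_diag X 0 j) = g (spectral_diag X 0 j)) ->
  funcalc f X = funcalc g X.
Proof.
move=> fg; rewrite /funcalc; set r := map_mx f _; set r' := map_mx g _.
by have -> : r = r' by apply/rowP => j; rewrite !mxE.
Qed.

Lemma mul_conjugated (K : pzRingType) (n : nat) (V W A B : 'M[K]_n) :
  V *m W = 1%:M -> W *m A *m V *m (W *m B *m V) = W *m (A *m B) *m V.
Proof. by move=> VW; rewrite -!mulmxA (mulmxA V) VW mul1mx. Qed.

Lemma funcalcM (R : realType) (d : nat) (f g : R[i] -> R[i]) (X : 'M[R[i]]_d) :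
  funcalc f X *m funcalc g X = funcalc (fun z => f z * g z) X.
Proof.
have VV := unitarymxP (spectral_unitarymx X).
rewrite /funcalc (mul_conjugated _ _ VV) mulmx_diag.
set r := \row_j _; set r' := map_mx (fun z => f z * g z) _.
by have -> : r = r' by apply/rowP => j; rewrite !mxE.
Qed.

Lemma funcalc_cst (R : realType) (d : nat) (a : R[i]) (X : 'M[R[i]]_d) :
  funcalc (fun=> a) X = a%:M.
Proof.
rewrite /funcalc; have -> : map_mx (fun=> a) (spectral_diag X) = const_mx a.
  by apply/rowP => j; rewrite !mxE.
rewrite diag_const_mx mul_mx_scalar -scalemxAl (mulmx1C (unitarymxP _)) ?scalemx1 //.
exact: spectral_unitarymx.
Qed.

Lemma funcalc_adj (R : realType) (d : nat) (f : R[i] -> R[i]) (X : 'M[R[i]]_d) :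
  (funcalc f X)^t* = funcalc (fun z => (f z)^*%R) X.
Proof.
rewrite /funcalc !adjmxM trmxCK mulmxA tr_diag_mx map_diag_mx.
set r := map_mx _ (map_mx f _); set r' := map_mx (fun z => (f z)^*%R) _.
by have -> : r = r' by apply/rowP => j; rewrite !mxE.
Qed.

Lemma tr_funcalc (R : realType) (d : nat) (f : R[i] -> R[i]) (X : 'M[R[i]]_d) :
  \tr (funcalc f X) = \sum_j f (spectral_diag X 0 j).
Proof.
rewrite /funcalc -mulmxA mxtrace_mulC -mulmxA.
rewrite (unitarymxP (spectral_unitarymx X)) mulmx1 mxtrace_diag.
by apply: eq_bigr => j _; rewrite mxE.
Qed.

(** * Orthogonal projections and the Loewner order *)

Definition orthoproj (R : realType) (d : nat) (P : 'M[R[i]]_d) : Prop :=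
  P^t* = P /\ P *m P = P.

Lemma orthoproj_subP (R : realType) (m d : nat) (M : 'M[R[i]]_(m, d))
    (Q : 'M[R[i]]_d) :
  orthoproj Q -> reflect (M *m Q = M) (M <= Q)%MS.
Proof.
move=> [_ QQ]; apply: (iffP submxP) => [[Y ->]|<-]; last by exists M.
by rewrite -mulmxA QQ.
Qed.

Lemma orthoproj_absorb (R : realType) (d : nat) (P Q : 'M[R[i]]_d) :
  orthoproj P -> orthoproj Q -> (P <= Q)%MS -> Q *m P = P.
Proof.
move=> [Ph _] Qp /(orthoproj_subP _ Qp) /(congr1 (fun M => M^t*)).
by rewrite adjmxM Ph (proj1 Qp).
Qed.

Lemma orthoproj_eq (R : realType) (d : nat) (P Q : 'M[R[i]]_d) :
  orthoproj P -> orthoproj Q -> (P :=: Q)%MS -> P = Q.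
Proof.
move=> hP hQ PQ; have [sPQ sQP] : (P <= Q)%MS /\ (Q <= P)%MS by rewrite !PQ.
by rewrite -(orthoproj_absorb hP hQ sPQ); apply/orthoproj_subP.
Qed.

Lemma sqnorm_ge0 (R : realType) (d : nat) (v : 'cV[R[i]]_d) :
  0 <= (v^t* *m v) 0 0.
Proof.
rewrite mxE sumr_ge0 // => j _; rewrite !mxE mulrC; exact: mul_conjC_ge0.
Qed.

Lemma sqnorm_le0_eq0 (R : realType) (d : nat) (v : 'cV[R[i]]_d) :
  (v^t* *m v) 0 0 <= 0 -> v = 0.
Proof.
move=> le0; have /eqP : (v^t* *m v) 0 0 = 0.
  by apply/eqP; rewrite eq_le le0 sqnorm_ge0.
rewrite mxE psumr_eq0 => [|j _]; last by rewrite !mxE mulrC mul_conjC_ge0.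
move=> /allP v0; apply/colP => j; have := v0 j (mem_index_enum _).
by rewrite !mxE /= mulrC mul_conjC_eq0 => /eqP.
Qed.

(** If P <= Q in the Loewner order, evaluating the form of Q - P at a vector w
    killed by Q gives - |P w|^2 >= 0, so P kills w too, that is P (1 - Q) = 0.
    If Ran P is inside Ran Q, then Q - P is itself an orthogonal projection and
    its form at v is |(Q - P) v|^2. *)
Lemma loewner_orthoproj (R : realType) (d : nat) (P Q : 'M[R[i]]_d) :
  orthoproj P -> orthoproj Q -> loewner_le P Q <-> (P <= Q)%MS.
Proof.
move=> hP hQ; have [Ph PP] := hP; have [Qh QQ] := hQ; split=> [PQ|sPQ v].
  (* [w] runs over the columns of [1 - Q], which span the kernel of [Q]. *)
  have PQ0 : P *m (1%:M - Q) = 0.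
    apply/matrixP => i j; set w := col j (1%:M - Q).
    have Qw : Q *m w = 0.
      by rewrite /w colE mulmxA mulmxBr mulmx1 QQ subrr mul0mx.
    have : P *m w = 0.
      apply: sqnorm_le0_eq0; rewrite adjmxM Ph -!mulmxA [P *m (P *m w)]mulmxA PP.
      have := PQ w; rewrite -mulmxA mulmxBl Qw sub0r mulmxN [X in 0 <= X]mxE.
      by rewrite oppr_ge0.
    move=> /colP/(_ i); rewrite /w colE mulmxA -colE => Pw.
    by move: Pw; rewrite mxE => ->; rewrite !mxE.
  apply/(orthoproj_subP _ hQ)/eqP; rewrite eq_sym -subr_eq0.
  by rewrite -[P in P - _]mulmx1 -mulmxBr PQ0.
have E : Q - P = (Q - P)^t* *m (Q - P).
  rewrite adjmxB Qh Ph mulmxBl !mulmxBr QQ PP.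
  by rewrite (orthoproj_absorb hP hQ sPQ) (elimT (orthoproj_subP _ hQ) sPQ) subrr subr0.
by rewrite E -!mulmxA !mulmxA -adjmxM -mulmxA sqnorm_ge0.
Qed.

(** The projection B' B, where the rows of B are an orthonormal basis of the
    row space of M and B' is the adjoint of B; as B B' = 1, its trace is the
    number of rows of B, the rank. Row spaces replace ranges throughout: for a
    Hermitian matrix they are complex conjugates of each other, so inclusions
    and dimensions are the same. *)
Definition rowproj (R : realType) (m d : nat) (M : 'M[R[i]]_(m, d)) : 'M[R[i]]_d :=
  (schmidt (row_base M))^t* *m schmidt (row_base M).

Lemma rowproj_orthoproj (R : realType) (m d : nat) (M : 'M[R[i]]_(m, d)) :
  orthoproj (rowproj M).
Proof.
have /unitarymxP BB := schmidt_unitarymx (row_base M) (rank_leq_col M).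
rewrite /rowproj; split; first by rewrite adjmxM trmxCK.
by rewrite mulmxA -[_ *m _ *m _^t*]mulmxA BB mulmx1.
Qed.

Lemma rowproj_eqmx (R : realType) (m d : nat) (M : 'M[R[i]]_(m, d)) :
  (rowproj M :=: M)%MS.
Proof.
have BM : (schmidt (row_base M) :=: M)%MS.
  exact: eqmx_trans (eqmx_schmidt_free (row_base_free M)) (eq_row_base M).
apply: eqmx_trans BM; apply/eqmxP; rewrite /rowproj submxMl /=.
have /unitarymxP BB := schmidt_unitarymx (row_base M) (rank_leq_col M).
by apply/submxP; exists (schmidt (row_base M)); rewrite mulmxA BB mul1mx.
Qed.

Lemma mxtrace_orthoproj (R : realType) (d : nat) (P : 'M[R[i]]_d) :
  orthoproj P -> \tr P = (\rank P)%:R.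
Proof.
move=> hP; have {1}<- := orthoproj_eq (rowproj_orthoproj P) hP (rowproj_eqmx P).
rewrite mxtrace_mulC (unitarymxP (schmidt_unitarymx _ (rank_leq_col P))).
by rewrite mxtrace1.
Qed.

(** * Eigenvalues and spectral projections *)

(** A list of reals with repetitions, so that multiplicities are handled by
    [perm_eq] and real order facts apply without casts. *)
Definition eigs (R : realType) (d : nat) (X : 'M[R[i]]_d) : seq R :=
  [seq complex.Re (spectral_diag X 0 j) | j <- index_enum 'I_d].

Lemma spectral_diagE (R : realType) (d : nat) (X : 'M[R[i]]_d) (j : 'I_d) :
  X \is hermsymmx -> spectral_diag X 0 j = (complex.Re (spectral_diag X 0 j))%:C.
Proof.
by move=> /hermitian_spectral_diag_real /mxOverP/(_ 0 j)/RRe_real.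
Qed.

Lemma specproj_orthoproj (R : realType) (d : nat) (X : 'M[R[i]]_d) (t : R) :
  orthoproj (specproj X t).
Proof.
split; first by rewrite funcalc_adj; apply: eq_funcalc => j; rewrite conjC_nat.
rewrite funcalcM; apply: eq_funcalc => j.
by case: (_ < _)%R; rewrite (mulr1, mulr0).
Qed.

Lemma spectral_leP (R : realType) (d : nat) (A B : 'M[R[i]]_d) :
  spectral_le A B <-> forall t, (specproj A t <= specproj B t)%MS.
Proof.
by split=> AB t;
  apply/(loewner_orthoproj (specproj_orthoproj A t) (specproj_orthoproj B t)).
Qed.

Lemma tr_funcalc_eigs (R : realType) (d : nat) (f : R[i] -> R[i]) (X : 'M[R[i]]_d) :
  X \is hermsymmx -> \tr (funcalc f X) = \sum_(x <- eigs X) f x%:C.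
Proof.
move=> hX; rewrite tr_funcalc big_map; apply: eq_bigr => j _.
by rewrite -spectral_diagE.
Qed.

(** The trace of a projection is its rank, while the trace of f(X) for an
    indicator f counts eigenvalues. This links subspaces, to which the
    dimension formula applies, to spectra. *)
Lemma rank_specproj (R : realType) (d : nat) (X : 'M[R[i]]_d) (t : R) :
  X \is hermsymmx -> \rank (specproj X t) = count (fun x => t < x) (eigs X).
Proof.
move=> hX; apply/eqP; rewrite -(eqr_nat R[i]) -mxtrace_orthoproj; last first.
  exact: specproj_orthoproj.
rewrite tr_funcalc_eigs // -sum1_count natr_sum [X in _ == X]big_mkcond /=.
by apply/eqP/eq_bigr => x _; rewrite ltcR; case: ifP.
Qed.

Lemma specproj_le (R : realType) (d : nat) (X : 'M[R[i]]_d) (s t : R) :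
  s <= t -> (specproj X t <= specproj X s)%MS.
Proof.
move=> st; apply/(orthoproj_subP _ (specproj_orthoproj X s)).
rewrite funcalcM; apply: eq_funcalc => j; have [tx|_] := boolP (t%:C < _)%R.
  by rewrite mul1r (le_lt_trans _ tx) // lecR.
by rewrite mul0r.
Qed.

Lemma mem_eigs (R : realType) (d : nat) (X : 'M[R[i]]_d) (j : 'I_d) :
  complex.Re (spectral_diag X 0 j) \in eigs X.
Proof. exact: map_f (mem_index_enum _). Qed.

Lemma specproj_gap (R : realType) (d : nat) (X : 'M[R[i]]_d) (s t : R) :
  X \is hermsymmx -> {in eigs X, forall x, (s < x) = (t < x)} ->
  specproj X s = specproj X t.
Proof.
move=> hX st; apply: eq_funcalc => j; rewrite spectral_diagE // !ltcR.
by rewrite st ?mem_eigs.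
Qed.

Lemma specproj_low (R : realType) (d : nat) (X : 'M[R[i]]_d) (t : R) :
  X \is hermsymmx -> {in eigs X, forall x, t < x} -> specproj X t = 1%:M.
Proof.
move=> hX tX; rewrite -(funcalc_cst 1 X); apply: eq_funcalc => j.
by rewrite spectral_diagE // ltcR tX ?mem_eigs.
Qed.

Lemma specproj_high (R : realType) (d : nat) (X : 'M[R[i]]_d) (t : R) :
  X \is hermsymmx -> {in eigs X, forall x, x <= t} -> specproj X t = 0.
Proof.
move=> hX tX.
have -> : (0 : 'M[R[i]]_d) = (0 : R[i])%:M by rewrite raddf0.
rewrite -(funcalc_cst 0 X); apply: eq_funcalc => j.
by rewrite spectral_diagE // ltcR ltNge tX ?mem_eigs.
Qed.

(** * Hermitian matrices with prescribed spectral subspaces *)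

Lemma exists_below (R : realDomainType) (s : seq R) :
  exists x0, {in s, forall x, x0 < x}.
Proof.
elim: s => [|y s [x0 x0s]]; first by exists 0.
exists (Num.min x0 (y - 1)) => x; rewrite inE gt_min => /predU1P[->|/x0s->//].
by rewrite ltrBlDr ltrDl ltr01 orbT.
Qed.

Lemma rowproj_mul (R : realType) (d : nat) (F : R -> 'M[R[i]]_d) (s t : R) :
  (forall s t, s <= t -> (F t <= F s)%MS) ->
  rowproj (F s) *m rowproj (F t) = rowproj (F (Num.max s t)).
Proof.
move=> Fle; have hP t' := rowproj_orthoproj (F t').
have Ple s' t' : s' <= t' -> (rowproj (F t') <= rowproj (F s'))%MS.
  by move=> st; rewrite !rowproj_eqmx Fle.
case: (leP s t) => st; first exact: orthoproj_absorb (Ple _ _ st).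
by apply/(orthoproj_subP _ (hP t))/Ple/ltW.
Qed.

(** Let P t be the projection onto F t and a_1 <= ... <= a_k the possible jumps
    in increasing order, with a_0 a point left of all of them, so that
    P a_0 = 1 and P a_k = 0. The differences Q_j = P a_j - P a_(j+1) are
    mutually orthogonal projections with sum 1. The matrix with eigenvalue
    a_(j+1) on Ran Q_j has the prescribed spectral subspaces: the sum of the
    Q_j with a_(j+1) > t telescopes to P t. *)
Lemma exists_spectral_family (R : realType) (d : nat) (F : R -> 'M[R[i]]_d)
    (ls : seq R) :
  (forall s t, s <= t -> (F t <= F s)%MS) ->
  (forall s t, {in ls, forall x, (s < x) = (t < x)} -> F s = F t) ->
  (forall t, {in ls, forall x, t < x} -> (F t :=: 1%:M)%MS) ->
  (forall t, {in ls, forall x, x <= t} -> F t = 0) ->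
  exists2 X : 'M[R[i]]_d, X \is hermsymmx & forall t, (specproj X t :=: F t)%MS.
Proof.
move=> Fle Fgap Flow Fhigh.
have [x0 x0ls] := exists_below ls.
pose a j := nth x0 (x0 :: sort <=%O ls) j; pose k := size ls.
have sorted_a : sorted <=%O (x0 :: sort <=%O ls).
  rewrite /= path_min_sorted ?(sort_le_sorted ls) //.
  by apply/allP => x; rewrite mem_sort => /x0ls/ltW.
have a_le i j : (i <= j <= k)%N -> a i <= a j.
  move=> /andP[ij jk]; apply: (le_sorted_leq_nth x0 sorted_a) => //.
    by rewrite inE /= size_sort ltnS (leq_trans ij).
  by rewrite inE /= size_sort ltnS.
pose P t := rowproj (F t).
have Plast : P (a k) = 0.
  rewrite /P Fhigh => [|x]; last first.
    rewrite -(mem_sort <=%O) => xls.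
    have kE : size (sort <=%O ls) = k by rewrite size_sort.
    have xl : (index x (sort <=%O ls) < k)%N by rewrite -kE index_mem.
    rewrite -(nth_index x0 xls) -[nth _ _ _]/(a (index x (sort <=%O ls)).+1).
    by apply: a_le; rewrite xl leqnn.
  by apply/eqmx0P; rewrite !rowproj_eqmx submx_refl.
have Pfirst t : t <= x0 -> P t = 1%:M.
  move=> tx0; apply: (orthoproj_eq (rowproj_orthoproj _)).
    by split; rewrite ?mulmx1 // trmx1 map_mx1.
  apply: eqmx_trans (rowproj_eqmx _) (Flow _ _) => x xls.
  by rewrite (le_lt_trans tx0) // x0ls.
pose Q j := P (a j) - P (a j.+1).
pose X := \sum_(j < k) (a j.+1)%:C *: Q j.
have hX : X \is hermsymmx.
  apply/hermsymmxP; rewrite adjmx_sum; apply: eq_bigr => j _.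
  rewrite adjmxZ adjmxB !(proj1 (rowproj_orthoproj _)).
  by rewrite conj_Creal // complex_real.
have PP s t' : P s *m P t' = P (Num.max s t') by exact: rowproj_mul.
(* For i < j all indices satisfy a_i <= a_(i+1) <= a_j <= a_(j+1), so by [PP]
   the four products cancel in pairs. *)
have QQ (i j : 'I_k) : Q i *m Q j = if i == j then Q j else 0.
  rewrite /Q mulmxBl !mulmxBr !PP.
  have a_leS (l : 'I_k) : a l <= a l.+1 by rewrite a_le // leqnSn ltn_ord.
  have asucc_le (l1 l2 : 'I_k) : (l1 < l2)%N -> a l1.+1 <= a l2.
    by move=> l12; rewrite a_le // l12 ltnW.
  have ale4 (l1 l2 : 'I_k) : (l1 < l2)%N ->
      [/\ a l1 <= a l2, a l1 <= a l2.+1, a l1.+1 <= a l2 & a l1.+1 <= a l2.+1].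
    move=> /asucc_le l12; have l1' := le_trans (a_leS l1) l12.
    by split=> //; apply: le_trans (a_leS l2).
  have [ij|ji|/val_inj->] := ltngtP i j.
  - have [h1 h2 h3 h4] := ale4 _ _ ij; rewrite !(max_idPr _) //.
    by rewrite subrr; case: eqP ij => // ->; rewrite ltnn.
  - have [h1 h2 h3 h4] := ale4 _ _ ji; rewrite !(max_idPl _) //.
    by rewrite subrr subrr subrr; case: eqP ji => // ->; rewrite ltnn.
  - by rewrite eqxx !maxxx (max_idPr (a_leS j)) (max_idPl (a_leS j)) subrr subr0.
have XQ (j : 'I_k) : X *m Q j = (a j.+1)%:C *: Q j.
  rewrite /X mulmx_suml (bigD1 j) //= -scalemxAl QQ eqxx big1 ?addr0 // => i.
  by rewrite -scalemxAl QQ => /negPf->; rewrite scaler0.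
have sumQ : \sum_(j < k) Q j = 1%:M.
  rewrite -(big_mkord xpredT Q) (@telescope_sumr_eq _ _ _ (fun j => - P (a j))) //.
    by rewrite Plast Pfirst //= oppr0 add0r opprK.
  by move=> j _; rewrite opprK addrC.
exists X => // t; rewrite -(mulmx1 (specproj X t)) -sumQ mulmx_sumr.
suff -> : \sum_(j < k) specproj X t *m Q j = P t by exact: rowproj_eqmx.
(* The j-th term is [Q j] if t < a_(j+1) and 0 otherwise; in both cases it is
   the difference of P at the points a_j and a_(j+1) pushed up to at least t,
   because P is constant between a_j and a_(j+1). The sum telescopes. *)
pose b j := Num.max (a j) t.
transitivity (\sum_(j < k) (P (b j) - P (b j.+1))).
  apply: eq_bigr => j _; rewrite /specproj (funcalc_eigen _ hX (XQ j)) ltcR.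
  rewrite /b /Q; have [ta|at_] := ltP t (a j.+1); rewrite ?scale1r ?scale0r.
    congr (_ - _).
    case: leP => // aj; rewrite /P; congr rowproj; apply: Fgap => x xls.
    (* [x] is some [a l.+1], hence not strictly between [a j] and [a j.+1]. *)
    have : x \in sort <=%O ls by rewrite mem_sort.
    move=> /(nthP x0)[l]; rewrite size_sort => lk <-; rewrite -[nth _ _ _]/(a l.+1).
    have [lj|jl] := leqP l.+1 j.
      have alj : a l.+1 <= a j by rewrite a_le // lj ltnW.
      by rewrite !ltNge alj (le_trans alj aj).
    have ajl : a j.+1 <= a l.+1 by rewrite a_le // jl.
    by rewrite !(lt_le_trans _ ajl) // (le_lt_trans aj).
  by rewrite (max_idPr (le_trans (a_le j j.+1 _) at_)) ?leqnSn ?ltn_ord // subrr.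
rewrite -(big_mkord xpredT (fun j => P (b j) - P (b j.+1))).
rewrite (@telescope_sumr_eq _ _ _ (fun j => - P (b j))) // => [|j _]; last first.
  by rewrite opprK addrC.
have -> : P (b k) = 0 by rewrite /b -PP Plast mul0mx.
rewrite oppr0 add0r opprK /b; case: leP => //= tx0.
by rewrite !Pfirst // ltW.
Qed.

(** * Joins and meets *)

(** Sums and intersections of the spectral subspaces of A and B form a
    decreasing family whose jumps are eigenvalues of A or B; [op] stands for
    either operation. *)
Lemma exists_specproj_op (R : realType) (d : nat)
    (op : 'M[R[i]]_d -> 'M[R[i]]_d -> 'M[R[i]]_d) (A B : 'M[R[i]]_d) :
  (forall P P' Q Q', (P <= P')%MS -> (Q <= Q')%MS -> (op P Q <= op P' Q')%MS) ->
  (op 1%:M 1%:M :=: 1%:M)%MS -> op 0 0 = 0 ->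
  A \is hermsymmx -> B \is hermsymmx ->
  exists2 C : 'M[R[i]]_d, C \is hermsymmx &
    forall t, (specproj C t :=: op (specproj A t) (specproj B t))%MS.
Proof.
move=> op_le op1 op0 hA hB.
apply: (@exists_spectral_family _ _ (fun t => op (specproj A t) (specproj B t))
  (eigs A ++ eigs B)) => [s t st|s t st|t tAB|t tAB].
- by rewrite op_le ?specproj_le.
- by rewrite (@specproj_gap _ _ A s t) ?(@specproj_gap _ _ B s t) // => x xX;
    rewrite st // mem_cat xX ?orbT.
- rewrite (specproj_low hA) ?(specproj_low hB) // => x xX;
    by rewrite tAB // mem_cat xX ?orbT.
- rewrite (specproj_high hA) ?(specproj_high hB) // => x xX;
    by rewrite tAB // mem_cat xX ?orbT.
Qed.

(** The matrix with spectral subspaces Ran E_A(t) + Ran E_B(t) is a supremum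
    because the sum is the least subspace containing both; any other supremum,
    in particular the chosen one, is below and above it, hence has the same
    spectral subspaces. *)
Lemma spectral_joinP (R : realType) (d : nat) (A B : 'M[R[i]]_d) :
  A \is hermsymmx -> B \is hermsymmx ->
  spectral_join A B \is hermsymmx /\
  forall t, (specproj (spectral_join A B) t :=: specproj A t + specproj B t)%MS.
Proof.
move=> hA hB; have [C hC CE] : exists2 C : 'M[R[i]]_d, C \is hermsymmx &
    forall t, (specproj C t :=: specproj A t + specproj B t)%MS.
  apply: (@exists_specproj_op _ _ (fun P Q => (P + Q)%MS)) => //.
  - by move=> P P' Q Q'; apply: addsmxS.
  - exact: addsmx_idPl.
  - exact: adds0mx_id.
have CP : is_spectral_sup A B C.
  split; first exact: hC.
  - by apply/spectral_leP => t; rewrite CE addsmxSl.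
  - by apply/spectral_leP => t; rewrite CE addsmxSr.
  - move=> X _ /spectral_leP AX /spectral_leP BX; apply/spectral_leP => t.
    by rewrite CE addsmx_sub AX BX.
have [hJ AJ BJ Jle] : is_spectral_sup A B (spectral_join A B).
  by apply: (@xgetPex _ 0 (is_spectral_sup A B)); exists C.
have [_ AC BC Cle] := CP.
have /spectral_leP JC := Jle C hC AC BC.
have /spectral_leP CJ := Cle _ hJ AJ BJ.
split=> [|t]; first exact: hJ.
by apply: eqmx_trans (CE t); apply/eqmxP; rewrite JC CJ.
Qed.

Lemma spectral_meetP (R : realType) (d : nat) (A B : 'M[R[i]]_d) :
  A \is hermsymmx -> B \is hermsymmx ->
  spectral_meet A B \is hermsymmx /\
  forall t, (specproj (spectral_meet A B) t :=: specproj A t :&: specproj B t)%MS.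
Proof.
move=> hA hB; have [C hC CE] : exists2 C : 'M[R[i]]_d, C \is hermsymmx &
    forall t, (specproj C t :=: specproj A t :&: specproj B t)%MS.
  apply: (@exists_specproj_op _ _ (fun P Q => (P :&: Q)%MS)) => //.
  - by move=> P P' Q Q'; apply: capmxS.
  - exact: capmx_idPl.
  - exact: cap0mx.
have CP : is_spectral_inf A B C.
  split; first exact: hC.
  - by apply/spectral_leP => t; rewrite CE capmxSl.
  - by apply/spectral_leP => t; rewrite CE capmxSr.
  - move=> X _ /spectral_leP AX /spectral_leP BX; apply/spectral_leP => t.
    by rewrite CE sub_capmx AX BX.
have [hM MA MB leM] : is_spectral_inf A B (spectral_meet A B).
  by apply: (@xgetPex _ 0 (is_spectral_inf A B)); exists C.
have [_ CA CB leC] := CP.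
have /spectral_leP CM := leM C hC CA CB.
have /spectral_leP MC := leC _ hM MA MB.
split=> [|t]; first exact: hM.
by apply: eqmx_trans (CE t); apply/eqmxP; rewrite MC CM.
Qed.

(** * The trace identity for two matrices *)

(** Spectral projections only see open half-lines; a point t of the gap left
    of x turns the closed half-line at x into the open half-line at t. *)
Lemma exists_left_gap (R : realFieldType) (s : seq R) (x : R) :
  exists2 t, t < x & {in s, forall y, (t < y) = (x <= y)}.
Proof.
elim: s => [|y s [t tx ts]]; first by exists (x - 1) => //; rewrite ltrBlDr ltrDl ltr01.
have [yx|xy] := ltP y x; last first.
  exists t => // z; rewrite inE => /predU1P[->|/ts//].
  by rewrite xy (lt_le_trans tx).
exists (Num.max t y) => [|z]; first by rewrite gt_max tx.
rewrite inE gt_max => /predU1P[->|zs]; first by rewrite ltxx andbF leNgt yx.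
rewrite ts //; have [xz|//] := leP x z.
by rewrite (lt_le_trans yx).
Qed.

(** The multiplicity of x is the number of entries >= x minus the number of
    entries > x, and the former is the number of entries > t for t in the gap
    left of x. *)
Lemma perm_eq_count_gt (R : realFieldType) (s1 s2 : seq R) :
  (forall t, count (fun x => t < x) s1 = count (fun x => t < x) s2) ->
  perm_eq s1 s2.
Proof.
move=> eq_above; apply/allP => x _ /=; apply/eqP.
have [t tx gap] := exists_left_gap (s1 ++ s2) x.
have countE s : {subset s <= s1 ++ s2} ->
    count (fun y => t < y) s = (count (fun y => x < y)%R s + count_mem x s)%N.
  move=> ss; rewrite -(count_predUI (fun y => x < y) (pred1 x)).
  rewrite (@eq_count _ (predI _ _) pred0) => [|y /=].
    rewrite count_pred0 addn0; apply: eq_in_count => y ys /=.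
    by rewrite gap ?ss // le_eqVlt orbC eq_sym.
  by case: eqP => [->|]; rewrite ?ltxx ?andbF.
have := eq_above t; rewrite !countE => [|y ys|y ys]; last 2 first.
- by rewrite mem_cat ys orbT.
- by rewrite mem_cat ys.
by rewrite eq_above => /addnI.
Qed.

(** The dimension formula
    dim (V + W) + dim (V :&: W) = dim V + dim W, applied to the spectral
    subspaces at every t. *)
Lemma perm_eigs_join_meet (R : realType) (d : nat) (A B : 'M[R[i]]_d) :
  A \is hermsymmx -> B \is hermsymmx ->
  perm_eq (eigs (spectral_join A B) ++ eigs (spectral_meet A B))
          (eigs A ++ eigs B).
Proof.
move=> hA hB; move: (spectral_joinP hA hB) (spectral_meetP hA hB).
move: (spectral_join A B) (spectral_meet A B) => J M [hJ JE] [hM ME].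
apply: perm_eq_count_gt => t; rewrite !count_cat.
rewrite -(rank_specproj t hJ) -(rank_specproj t hM) (JE t) (ME t).
rewrite -(rank_specproj t hA) -(rank_specproj t hB).
exact: mxrank_sum_cap.
Qed.

Lemma tr_funcalc_join_meet (R : realType) (d : nat) (f : R[i] -> R[i])
    (A B : 'M[R[i]]_d) :
  A \is hermsymmx -> B \is hermsymmx ->
  \tr (funcalc f (spectral_join A B)) + \tr (funcalc f (spectral_meet A B)) =
  \tr (funcalc f A) + \tr (funcalc f B).
Proof.
move=> hA hB; move: (spectral_joinP hA hB).1 (spectral_meetP hA hB).1.
move: (perm_eigs_join_meet hA hB).
move: (spectral_join A B) (spectral_meet A B) => J M eqJM hJ hM.
rewrite (tr_funcalc_eigs f hJ) (tr_funcalc_eigs f hM) -big_cat.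
rewrite (tr_funcalc_eigs f hA) (tr_funcalc_eigs f hB) -big_cat.
exact: perm_big eqJM.
Qed.

(** * Block-diagonal matrices and unitary equivalence *)

Lemma map_mxblock (T S : Type) (f : T -> S) (m n : nat)
    (p : 'I_m -> nat) (q : 'I_n -> nat) (B : forall i j, 'M[T]_(p i, q j)) :
  map_mx f (\mxblock_(i, j) B i j) = \mxblock_(i, j) map_mx f (B i j).
Proof. by apply/matrixP => a b; rewrite !mxE. Qed.

Lemma adj_mxdiag (C : numClosedFieldType) (m : nat) (p : 'I_m -> nat)
    (X : forall i, 'M[C]_(p i)) :
  (\mxdiag_i X i)^t* = \mxdiag_i (X i)^t*.
Proof.
rewrite tr_mxdiag /mxdiag map_mxblock; apply/eq_mxblock => i j.
case: eqVneq => [E|_]; first by case: _ / E; rewrite !conform_mx_id.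
by apply/matrixP => a b; rewrite !mxE conjC0.
Qed.

Lemma mul_mxdiag (K : pzRingType) (m : nat) (p : 'I_m -> nat)
    (X Y : forall i, 'M[K]_(p i)) :
  (\mxdiag_i X i) *m (\mxdiag_i Y i) = \mxdiag_i (X i *m Y i).
Proof.
rewrite {2}/mxdiag mul_mxdiag_mxblock; apply/eq_mxblock => i j.
by case: eqVneq => [E|_]; [case: _ / E; rewrite !conform_mx_id | rewrite mulmx0].
Qed.

Lemma mxdiag_hermsymmx (R : realType) (m : nat) (p : 'I_m -> nat)
    (X : forall i, 'M[R[i]]_(p i)) :
  (forall i, X i \is hermsymmx) -> \mxdiag_i X i \is hermsymmx.
Proof.
move=> hX; apply/hermsymmxP; rewrite adj_mxdiag; apply: eq_mxdiag => i.
exact/hermsymmxP.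
Qed.

(** The block diagonal of the eigenvector matrices intertwines the block
    diagonal of the [X i] with a diagonal matrix. *)
Lemma funcalc_mxdiag (R : realType) (m : nat) (p : 'I_m -> nat)
    (f : R[i] -> R[i]) (X : forall i, 'M[R[i]]_(p i)) :
  (forall i, X i \is hermsymmx) ->
  funcalc f (\mxdiag_i X i) = \mxdiag_i (funcalc f (X i)).
Proof.
move=> hX; pose V i := spectralmx (X i); pose W := \mxdiag_i (V i)^t*.
have VV' i : (V i)^t* *m V i = 1%:M.
  exact/mulmx1C/unitarymxP/spectral_unitarymx.
have WV : W *m \mxdiag_i V i = 1%:M.
  by rewrite mul_mxdiag (eq_mxdiag VV') mxdiagZ.
have hD : \mxdiag_i X i \is hermsymmx by exact: mxdiag_hermsymmx.
have DW : \mxdiag_i X i *m W = W *m diag_mx (\mxrow_i spectral_diag (X i)).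
  rewrite diag_mxrow !mul_mxdiag; apply: eq_mxdiag => i.
  exact: mul_spectralmx_adj.
rewrite -[LHS]mulmx1 -WV mulmxA (funcalc_intertwine f hD DW).
have -> : map_mx f (\mxrow_i spectral_diag (X i)) =
          \mxrow_i map_mx f (spectral_diag (X i)).
  by apply/rowP => j; rewrite !mxE.
by rewrite diag_mxrow !mul_mxdiag.
Qed.

Lemma tr_funcalc_mxdiag (R : realType) (m : nat) (p : 'I_m -> nat)
    (f : R[i] -> R[i]) (X : forall i, 'M[R[i]]_(p i)) :
  (forall i, X i \is hermsymmx) ->
  \tr (funcalc f (\mxdiag_i X i)) = \sum_i \tr (funcalc f (X i)).
Proof. by move=> hX; rewrite (funcalc_mxdiag f hX) mxtrace_mxdiag. Qed.

(** Taking for f the indicator of a point z, the trace of f(X) is the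
    multiplicity of z, so X and Y have the same eigenvalues up to a
    permutation s; conjugating by the permutation matrix of s between the two
    eigenbases carries Y to X. *)
Lemma unitarily_equiv_of_trace (R : realType) (n : nat) (X Y : 'M[R[i]]_n) :
  X \is hermsymmx -> Y \is hermsymmx ->
  (forall f, \tr (funcalc f X) = \tr (funcalc f Y)) -> unitarily_equiv X Y.
Proof.
move=> hX hY trXY.
pose tX := [tuple spectral_diag X 0 j | j < n].
pose tY := [tuple spectral_diag Y 0 j | j < n].
have tXY : perm_eq tX tY.
  apply/allP => z _ /=; apply/eqP.
  have cE (Z : 'M[R[i]]_n) : (count_mem z [tuple spectral_diag Z 0 j | j < n])%:R =
      \tr (funcalc (fun x => (x == z)%:R) Z).
    rewrite tr_funcalc -sum1_count natr_sum big_mkcond /= big_map big_enum /=.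
    by apply: eq_bigr => j _; case: ifP.
  by apply/eqP; rewrite -(eqr_nat R[i]) !cE trXY.
have /tuple_permP[s sE] := tXY.
have sdE j : spectral_diag X 0 j = spectral_diag Y 0 (s j).
  have := congr1 (fun t => nth 0 t j) sE.
  by rewrite -!tnth_nth !tnth_mktuple.
pose S : 'M[R[i]]_n := perm_mx s.
have Sadj : S^t* = perm_mx s^-1 by rewrite tr_perm_mx map_perm_mx.
have hS : S \is unitarymx.
  by apply/unitarymxP; rewrite Sadj -perm_mxM mulgV perm_mx1.
have SD : S *m diag_mx (spectral_diag Y) *m S^t* = diag_mx (spectral_diag X).
  rewrite Sadj -row_permE -[s^-1%g]invgK -col_permE invgK.
  by apply/matrixP => i j; rewrite !mxE sdE (inj_eq perm_inj).
pose U := (spectralmx X)^t* *m S *m spectralmx Y.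
exists U; first by rewrite /U !mul_unitarymx ?trmxC_unitary ?spectral_unitarymx.
have := unitarymxP (spectral_unitarymx Y).
move: (spectralE hX) (spectralE hY); rewrite -SD {}/U.
move: (spectralmx X) (spectralmx Y) (diag_mx _) S {Sadj hS SD}.
move=> V W E S XE YE WW; rewrite XE YE !adjmxM trmxCK -!mulmxA.
by rewrite (mulmxA W) WW mul1mx (mulmxA W) WW mul1mx.
Qed.

Theorem corollary2p3 (R : realType) (d m : nat) (A C D : nat -> 'M[R[i]]_d)
    (hm : (2 <= m)%N)
    (hA : forall j : nat, (1 <= j <= m)%N -> A j \is hermsymmx)
    (hC1 : C 1%N = A 1%N)
    (hC : forall j : nat, (2 <= j <= m)%N ->
            C j = spectral_join (C j.-1) (A j))
    (hD : forall j : nat, (2 <= j <= m)%N ->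
            D j = spectral_meet (C j.-1) (A j)) :
  unitarily_equiv
    (\mxdiag_(i < m) (if (i : nat) == 0%N then C m else D i.+1))
    (\mxdiag_(i < m) A i.+1)
  /\ forall f : R[i] -> R[i],
       \tr (funcalc f (C m)) + \sum_(2 <= j < m.+1) \tr (funcalc f (D j))
       = \sum_(1 <= j < m.+1) \tr (funcalc f (A j)).
Proof.
have joins k : (k < m)%N -> C k.+1 \is hermsymmx /\ forall f : R[i] -> R[i],
    \tr (funcalc f (C k.+1)) + \sum_(2 <= j < k.+2) \tr (funcalc f (D j)) =
    \sum_(1 <= j < k.+2) \tr (funcalc f (A j)).
  elim: k => [|k IHk] km.
    rewrite hC1; split=> [|f]; first by rewrite hA.
    by rewrite big_geq // addr0 big_nat1.
  have [hCk IH] := IHk (ltnW km); have hAk : A k.+2 \is hermsymmx by rewrite hA.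
  rewrite hC ?km //=; split=> [|f]; first exact: (spectral_joinP hCk hAk).1.
  rewrite big_nat_recr //= [in RHS]big_nat_recr //= -IH (hD k.+2) ?km //=.
  by rewrite addrCA (tr_funcalc_join_meet f hCk hAk) addrCA addrA.
have hD' j : (2 <= j <= m)%N -> D j \is hermsymmx.
  case: j => [|[|j]] // jm; rewrite (hD j.+2 jm).
  exact: (spectral_meetP (joins j (ltnW jm)).1 (hA j.+2 jm)).1.
case: m hm hA hC hD joins hD' => // n _ hA' _ _ /(_ n (leqnn _))[hCm trCD] hD'.
split; last exact: trCD.
pose CD (i : 'I_n.+1) := if (i : nat) == 0%N then C n.+1 else D i.+1.
have hCD i : CD i \is hermsymmx.
  rewrite /CD; case: ifPn => [_|i0]; first exact: hCm.
  by apply: hD'; rewrite ltnS lt0n i0 ltn_ord.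
have hAi (i : 'I_n.+1) : A i.+1 \is hermsymmx by apply: hA'; rewrite ltn_ord.
apply: unitarily_equiv_of_trace => [||f].
- exact: mxdiag_hermsymmx hCD.
- exact: mxdiag_hermsymmx hAi.
apply: etrans (tr_funcalc_mxdiag f hCD) _.
apply: etrans _ (esym (tr_funcalc_mxdiag f hAi)).
have sum1 (g : nat -> R[i]) : \sum_(1 <= j < n.+2) g j = \sum_(i < n.+1) g i.+1.
  by rewrite big_add1 big_mkord.
have sum2 (g : nat -> R[i]) : \sum_(2 <= j < n.+2) g j = \sum_(i < n) g i.+2.
  by rewrite big_add1 big_add1 big_mkord.
rewrite -(sum1 (fun j => \tr (funcalc f (A j)))) -(trCD f) sum2.
exact: big_ord_recl.
Qed.
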